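(* Let $\eta_k$, $k^*$ and the notion of near best rank $k$ approximation be as defined in the context. Then $P_{k+1}B_kQ_k^T$ is a near best rank $k$ approximation to $A$ if $$\sqrt{1+\eta_k^2}<\frac12\frac{\sigma_k}{\sigma_{k+1}}+\frac12.$$ Furthermore, for $k=1,2,\ldots,k^*$, $P_{k+1}B_kQ_k^T$ is a near best rank $k$ approximation to $A$ in each of the following cases: (a) the problem is severely ill-posed with $\sigma_i=\zeta\rho^{-i}$, $i=1,\ldots,n$, $\zeta>0$, and $\rho>2$; (b) the problem is moderately or mildly ill-posed with $\sigma_i=\zeta i^{-\alpha}$, $i=1,\ldots,n$, $\zeta>0$, $\alpha>\frac12$, and $\alpha$ satisfies $$2\sqrt{1+\eta_k^2}-1<\left(\frac{k+1}{k}\right)^{\alpha},\qquad k=1,2,\ldots,k^*.$$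
   Context: $\|\cdot\|$ is the 2-norm (spectral norm for matrices). $A\in\mathbb{R}^{m\times n}$, $m\geq n$, has the SVD $A=U\begin{pmatrix}\Sigma\\ \mathbf 0\end{pmatrix}V^T$ with $U=(u_1,\ldots,u_m)$, $V=(v_1,\ldots,v_n)$ orthogonal, $\Sigma=\mathrm{diag}(\sigma_1,\ldots,\sigma_n)$, and simple singular values $\sigma_1>\cdots>\sigma_n>0$; $\Sigma_k=\mathrm{diag}(\sigma_1,\ldots,\sigma_k)$. The vector $b=b_{true}+e\in\mathbb{R}^m$, with $b_{true}=Ax_{true}$, satisfies $u_i^Tb\neq0$ for $i=1,\ldots,n$. Throughout $1\leq k\leq n-1$. Picard model: $|u_i^Tb_{true}|=\sigma_i^{1+\beta}$, $i=1,\ldots,n$, for some $\beta>0$; $e$ is Gaussian white noise with $|u_i^Te|\approx\eta$ for all $i$ (the noise level $\eta$ is unrelated to $\eta_k$). The transition point $k_0$ is the index with $|u_{k_0}^Tb|\approx|u_{k_0}^Tb_{true}|>|u_{k_0}^Te|\approx\eta$ and $|u_{k_0+1}^Tb|\approx|u_{k_0+1}^Te|\approx\eta$. These approximate relations are read in idealized form: $|u_i^Tb|=\sigma_i^{1+\beta}$ for $i\leq k_0$, and $\frac{\max_{k+1\leq i\leq n}|u_i^Tb|}{\min_{1\leq i\leq k}|u_i^Tb|}=\frac{\sigma_{k+1}^{1+\beta}}{\sigma_k^{1+\beta}}<1$ for $k=1,\ldots,k_0$. Lanczos bidiagonalization: starting from $b$, put $\beta_1p_1=b$, $\alpha_1q_1=A^Tp_1$,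 and for $i\geq1$, $\beta_{i+1}p_{i+1}=Aq_i-\alpha_ip_i$, $\alpha_{i+1}q_{i+1}=A^Tp_{i+1}-\beta_{i+1}q_i$, with the positive numbers $\alpha_i,\beta_i$ normalizing $q_i,p_i$ to unit length. With $P_{k+1}=(p_1,\ldots,p_{k+1})$ and $Q_k=(q_1,\ldots,q_k)$, the columns of $Q_k$ are an orthonormal basis of the Krylov subspace $\mathrm{span}\{A^Tb,(A^TA)A^Tb,\ldots,(A^TA)^{k-1}A^Tb\}$, $P_{k+1}$ has orthonormal columns, and $AQ_k=P_{k+1}B_k$, where $B_k\in\mathbb{R}^{(k+1)\times k}$ is lower bidiagonal with diagonal $\alpha_1,\ldots,\alpha_k$ and subdiagonal $\beta_2,\ldots,\beta_{k+1}$. The process runs without breakdown. LSQR and $k^*$: the $k$-th LSQR iterate is $x_k^{lsqr}=Q_kB_k^{\dagger}P_{k+1}^Tb$ ($\dagger$ is the Moore-Penrose inverse). The iterates first approach $x_{true}$ and then move away from it (semi-convergence); $k^*$ is the iteration at which semi-convergence occurs, i.e. at which $x_k^{lsqr}$ is the best approximation to $x_{true}$. It is known from earlier work that $k^*\leq k_0$. Near best: with $\gamma_k=\|A-P_{k+1}B_kQ_k^T\|$, the matrix $P_{k+1}B_kQ_k^T$ is called a near best rank $k$ approximation to $A$ if $\sigma_{k+1}\leq\gamma_k<\frac{\sigma_k+\sigma_{k+1}}{2}$. Definition of $\Delta_k$: let $D=\mathrm{diag}(\sigma_ju_j^Tb)_{j=1}^n$ and let $T_k\in\mathbb{R}^{n\times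 k}$ be the matrix whose $j$-th row is $(1,\sigma_j^2,\ldots,\sigma_j^{2k-2})$. Partition $D=\mathrm{diag}(D_1,D_2)$ and $T_k=\begin{pmatrix} T_{k1} \\ T_{k2} \end{pmatrix}$ with $D_1,T_{k1}\in\mathbb{R}^{k\times k}$. Then $\Delta_k=D_2T_{k2}T_{k1}^{-1}D_1^{-1}\in\mathbb{R}^{(n-k)\times k}$. Definition of $\eta_k$: $\eta_k=\epsilon_k/\sigma_{k+1}$ with $\epsilon_k\geq0$ given by $\epsilon_k^2=\|\Sigma_k(I+\Delta_k^T\Delta_k)^{-1}\Delta_k^T\Delta_k\|^2+\|\Sigma_k(I+\Delta_k^T\Delta_k)^{-1}\Delta_k^T\|^2$. *)

(* Defs.v *)
From HB Require Import structures.
From mathcomp Require Import all_boot all_order all_algebra.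
From mathcomp Require Import boolp classical_sets reals exp.

Set Implicit Arguments.
Unset Strict Implicit.
Unset Printing Implicit Defensive.

Import Order.TTheory GRing.Theory Num.Theory.

Local Open Scope ring_scope.
Local Open Scope classical_set_scope.

(* Every family u_1, u_2, ... is a function of a natural number, read at the
   indices 1, 2, ... as on paper; values outside the stated range (in
   particular at 0) are irrelevant. *)

Section Norms.
Variable R : realType.

Definition dotv m (x y : 'cV[R]_m) : R := (x^T *m y) 0 0.

(* The norm that MathComp-Analysis puts on matrices is the sup norm, hence
   these definitions of the 2-norm and of the induced spectral norm. *)
Definition vnorm2 m (x : 'cV[R]_m) : R := Num.sqrt (dotv x x).

Definition mnorm2 m n (M : 'M[R]_(m, n)) : R :=
  sup [set vnorm2 (M *m x) | x in [set x : 'cV[R]_n | vnorm2 x <= 1]].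

Definition orthogonal_mx m (U : 'M[R]_m) : Prop := U^T *m U = 1%:M.

End Norms.

Section MoorePenrose.
Variable R : realType.

Record penrose m n (B : 'M[R]_(m, n)) (X : 'M[R]_(n, m)) : Prop := Penrose {
  penrose1 : B *m X *m B = B;
  penrose2 : X *m B *m X = X;
  penrose3 : (B *m X)^T = B *m X;
  penrose4 : (X *m B)^T = X *m B }.

Definition pinv m n (B : 'M[R]_(m, n)) : 'M[R]_(n, m) :=
  xget 0 [set X | penrose B X].

Lemma mulmx_tr_eq0 m n (x : 'M[R]_(m, n)) : x *m x^T = 0 -> x = 0.
Proof.
move=> /matrixP x0; apply/matrixP => i j; rewrite mxE.
have := x0 i i; rewrite !mxE => /eqP; rewrite psumr_eq0 => [|k _].
  move/allP/(_ j (mem_index_enum _)); rewrite /= mxE mulf_eq0 orbb.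
  by move/eqP.
by rewrite mxE -expr2 sqr_ge0.
Qed.

Lemma gram_unitmx r n (F : 'M[R]_(r, n)) : row_free F -> F *m F^T \in unitmx.
Proof.
move=> /row_freeP[G FG]; rewrite -row_free_unit -kermx_eq0.
set K := kermx _; apply/eqP.
have KF0 : K *m F = 0.
  apply: mulmx_tr_eq0; rewrite trmx_mul mulmxA -(mulmxA K F).
  by rewrite mulmx_ker mul0mx.
by rewrite -(mulmx1 K) -FG mulmxA KF0 mul0mx.
Qed.

Lemma penrose_full_rank m r n (C : 'M[R]_(m, r)) (F : 'M[R]_(r, n)) :
  row_free C^T -> row_free F -> exists X, penrose (C *m F) X.
Proof.
move=> /gram_unitmx; rewrite trmxK => uC /gram_unitmx uF.
pose G := invmx (F *m F^T); pose H := invmx (C^T *m C).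
have FG : F *m F^T *m G = 1%:M by exact: mulmxV.
have HC : H *m (C^T *m C) = 1%:M by exact: mulVmx.
have GT : G^T = G by rewrite /G trmx_inv trmx_mul trmxK.
have HT : H^T = H by rewrite /H trmx_inv trmx_mul trmxK.
pose X := F^T *m G *m (H *m C^T).
have BX : C *m F *m X = C *m (H *m C^T).
  by rewrite /X -!(mulmxA C) !(mulmxA F) FG mul1mx.
have XB : X *m (C *m F) = F^T *m G *m F.
  by rewrite /X -mulmxA (mulmxA (H *m _)) -(mulmxA H) HC mul1mx.
exists X; split.
- by rewrite -mulmxA XB -(mulmxA C) !(mulmxA F) FG mul1mx.
- by rewrite XB /X -(mulmxA _ F) !(mulmxA F) FG mul1mx.
- by rewrite BX !trmx_mul trmxK HT mulmxA.
- by rewrite XB !trmx_mul trmxK GT mulmxA.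
Qed.

Lemma penrose_exists m n (B : 'M[R]_(m, n)) : exists X, penrose B X.
Proof.
rewrite -(mulmx_base B); apply: penrose_full_rank; last exact: row_base_free.
by rewrite /row_free mxrank_tr; have := col_base_full B.
Qed.

Lemma pinvP m n (B : 'M[R]_(m, n)) : penrose B (pinv B).
Proof. exact: (xgetPex 0 (penrose_exists B)). Qed.

Lemma penrose_uniq m n (B : 'M[R]_(m, n)) X Y :
  penrose B X -> penrose B Y -> X = Y.
Proof.
move=> [X1 X2 X3 X4] [Y1 Y2 Y3 Y4].
have BXY : B *m X = B *m Y.
  by rewrite -X3 -{1}Y1 -mulmxA trmx_mul X3 Y3 mulmxA X1.
have XYB : X *m B = Y *m B.
  by rewrite -X4 -{1}Y1 -!mulmxA mulmxA trmx_mul X4 Y4 -mulmxA (mulmxA B) X1.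
by rewrite -X2 XYB -mulmxA BXY mulmxA Y2.
Qed.

End MoorePenrose.

Section LSQR.
Variable R : realType.

(* (x_1, ..., x_k) *)
Definition cols_mx m (x : nat -> 'cV[R]_m) (k : nat) : 'M[R]_(m, k) :=
  \matrix_(i < m, j < k) x j.+1 i 0.

(* diag(f_(lo+1), ..., f_(lo+r)) *)
Definition diag_block (f : nat -> R) (lo r : nat) : 'M[R]_r :=
  diag_mx (\row_(j < r) f (lo + j).+1).

Definition rect_diag m n (sigma : nat -> R) : 'M[R]_(m, n) :=
  \matrix_(i < m, j < n) (if i == j :> nat then sigma j.+1 else 0).

Record simple_svd m n (A : 'M[R]_(m, n)) (u : nat -> 'cV[R]_m)
    (v : nat -> 'cV[R]_n) (sigma : nat -> R) : Prop := SimpleSVD {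
  svd_left : orthogonal_mx (cols_mx u m);
  svd_right : orthogonal_mx (cols_mx v n);
  svd_fact : A = cols_mx u m *m rect_diag m n sigma *m (cols_mx v n)^T;
  svd_simple : forall i, (1 <= i < n)%N -> sigma i.+1 < sigma i;
  svd_pos : forall i, (1 <= i <= n)%N -> 0 < sigma i }.

(* N steps without breakdown. *)
Record lanczos_bidiag m n (A : 'M[R]_(m, n)) (b : 'cV[R]_m) (N : nat)
    (alpha beta : nat -> R) (p : nat -> 'cV[R]_m) (q : nat -> 'cV[R]_n)
    : Prop := LanczosBidiag {
  lanczos_p1 : beta 1%N *: p 1%N = b;
  lanczos_q1 : alpha 1%N *: q 1%N = A^T *m p 1%N;
  lanczos_pS : forall i, (1 <= i < N)%N ->
    beta i.+1 *: p i.+1 = A *m q i - alpha i *: p i;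
  lanczos_qS : forall i, (1 <= i < N)%N ->
    alpha i.+1 *: q i.+1 = A^T *m p i.+1 - beta i.+1 *: q i;
  lanczos_pos : forall i, (1 <= i <= N)%N -> 0 < alpha i /\ 0 < beta i;
  lanczos_unit : forall i, (1 <= i <= N)%N ->
    vnorm2 (p i) = 1 /\ vnorm2 (q i) = 1 }.

(* Row i and column j are counted from 0, so the diagonal entry of column j is
   alpha_(j+1) and the entry just below it is beta_(j+2). *)
Definition bidiag_mx (alpha beta : nat -> R) (k : nat) : 'M[R]_(k.+1, k) :=
  \matrix_(i < k.+1, j < k)
    (if i == j :> nat then alpha j.+1
     else if i == j.+1 :> nat then beta j.+2 else 0).

Definition lsqr_iterate m n (b : 'cV[R]_m) (alpha beta : nat -> R)
    (p : nat -> 'cV[R]_m) (q : nat -> 'cV[R]_n) (k : nat) : 'cV[R]_n :=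
  cols_mx q k *m pinv (bidiag_mx alpha beta k) *m (cols_mx p k.+1)^T *m b.

Definition lanczos_approx m n (alpha beta : nat -> R)
    (p : nat -> 'cV[R]_m) (q : nat -> 'cV[R]_n) (k : nat) : 'M[R]_(m, n) :=
  cols_mx p k.+1 *m bidiag_mx alpha beta k *m (cols_mx q k)^T.

(* To be used with X = P_(k+1) B_k Q_k^T, so that the norm is gamma_k. *)
Definition near_best m n (A : 'M[R]_(m, n)) (sigma : nat -> R) (k : nat)
    (X : 'M[R]_(m, n)) : Prop :=
  sigma k.+1 <= mnorm2 (A - X) < (sigma k + sigma k.+1) / 2.

(* Rows lo+1, ..., lo+r of T_k. *)
Definition krylov_vdm (sigma : nat -> R) (k lo r : nat) : 'M[R]_(r, k) :=
  \matrix_(i < r, j < k) sigma (lo + i).+1 ^+ (2 * j).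

Definition krylov_Delta m (n : nat) (u : nat -> 'cV[R]_m) (sigma : nat -> R)
    (b : 'cV[R]_m) (k : nat) : 'M[R]_(n - k, k) :=
  let d := fun j => sigma j * dotv (u j) b in
  let D1 := diag_block d 0 k in
  let D2 := diag_block d k (n - k) in
  let T1 := krylov_vdm sigma k 0 k in
  let T2 := krylov_vdm sigma k k (n - k) in
  D2 *m T2 *m invmx T1 *m invmx D1.

Definition krylov_eps m (n : nat) (u : nat -> 'cV[R]_m) (sigma : nat -> R)
    (b : 'cV[R]_m) (k : nat) : R :=
  let S := diag_block sigma 0 k in
  let E := krylov_Delta n u sigma b k in
  let G := invmx (1%:M + E^T *m E) in
  Num.sqrt (mnorm2 (S *m G *m E^T *m E) ^+ 2 + mnorm2 (S *m G *m E^T) ^+ 2).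

Definition krylov_eta m (n : nat) (u : nat -> 'cV[R]_m) (sigma : nat -> R)
    (b : 'cV[R]_m) (k : nat) : R :=
  krylov_eps n u sigma b k / sigma k.+1.

Definition picard m (n : nat) (u : nat -> 'cV[R]_m) (sigma : nat -> R)
    (btrue : 'cV[R]_m) (beta : R) : Prop :=
  forall i, (1 <= i <= n)%N -> `|dotv (u i) btrue| = sigma i `^ (1 + beta).

(* The absolute values being nonnegative, the start value 0 is harmless in the
   maximum; the minimum starts from its own first term. *)
Definition coef_ratio m (n : nat) (u : nat -> 'cV[R]_m) (b : 'cV[R]_m)
    (k : nat) : R :=
  (\big[Num.max/0]_(k.+1 <= i < n.+1) `|dotv (u i) b|) /
  (\big[Num.min/`|dotv (u 1%N) b|]_(1 <= i < k.+1) `|dotv (u i) b|).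

Record transition_point m (n : nat) (u : nat -> 'cV[R]_m) (sigma : nat -> R)
    (b : 'cV[R]_m) (beta : R) (k0 : nat) : Prop := TransitionPoint {
  transition_range : (1 <= k0 < n)%N;
  transition_coef : forall i, (1 <= i <= k0)%N ->
    `|dotv (u i) b| = sigma i `^ (1 + beta);
  transition_ratio : forall k, (1 <= k <= k0)%N ->
    coef_ratio n u b k = sigma k.+1 `^ (1 + beta) / sigma k `^ (1 + beta) /\
    coef_ratio n u b k < 1 }.

(* kstar is an index whose iterate is the best approximation to xtrue among
   the iterates x_1, ..., x_(n-1). *)
Definition semi_convergence_at n (x : nat -> 'cV[R]_n) (xtrue : 'cV[R]_n)
    (kstar : nat) : Prop :=
  (1 <= kstar < n)%N /\
  forall j, (1 <= j < n)%N -> vnorm2 (x kstar - xtrue) <= vnorm2 (x j - xtrue).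

End LSQR.

(* Main.v *)
Require Import Defs.
From HB Require Import structures.
From mathcomp Require Import all_boot all_order all_algebra.
From mathcomp Require Import boolp classical_sets reals exp.
From mathcomp Require Import ring lra zify.

Set Implicit Arguments.
Unset Strict Implicit.
Unset Printing Implicit Defensive.

Import Order.TTheory GRing.Theory Num.Theory.

Local Open Scope ring_scope.

(* Since P_(k+1) B_k Q_k^T = A Q Q^T, where Q spans the Krylov space, gamma_k is
   the norm of A (I - Q Q^T).  In the coordinates of the right singular vectors
   Q spans the range of (I; Delta), so a residual z = (I - Q Q^T) y satisfies
   z_1 = - Delta^T z_2 and z_1 = G Delta^T Delta y_1 - G Delta^T y_2, with
   G = (I + Delta^T Delta)^-1.  Hence ||Sigma z||^2 is at most
   ||Sigma_k z_1||^2 + sigma_(k+1)^2 ||z_2||^2 <= eps_k^2 + sigma_(k+1)^2 for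
   ||y|| <= 1.  The lower bound comes from a vector of the span of
   v_1, ..., v_(k+1) that is orthogonal to Q.

   In case (a) the estimate of z_1 by - Delta^T z_2 is used instead: it gives
   gamma_k^2 <= sigma_(k+1)^2 + ||Delta Sigma_k||^2.  The entries of
   T_k2 T_k1^-1 are values of Lagrange polynomials, bounded by 3/2 since
   1 - sum_d rho^(-2d) >= 2/3, and the Picard decay makes the squared Frobenius
   norm of Delta Sigma_k at most 9/4 * 4/3 * 1/3 * sigma_(k+1)^2.  Therefore
   gamma_k <= sqrt 2 sigma_(k+1) < 3/2 sigma_(k+1) < (sigma_k + sigma_(k+1))/2. *)

(** * Euclidean and spectral norms *)

Section EuclideanNorm.
Variable R : realType.

Lemma dotvE m (x y : 'cV[R]_m) : dotv x y = \sum_i x i 0 * y i 0.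
Proof. by rewrite /dotv mxE; apply: eq_bigr => i _; rewrite mxE. Qed.

Lemma dotvC m (x y : 'cV[R]_m) : dotv x y = dotv y x.
Proof. by rewrite !dotvE; apply: eq_bigr => i _; rewrite mulrC. Qed.

Lemma dotvDl m (x y z : 'cV[R]_m) : dotv (x + y) z = dotv x z + dotv y z.
Proof. by rewrite /dotv linearD mulmxDl mxE. Qed.

Lemma dotvZl m a (x z : 'cV[R]_m) : dotv (a *: x) z = a * dotv x z.
Proof. by rewrite /dotv linearZ -scalemxAl mxE. Qed.

Lemma dotvBl m (x y z : 'cV[R]_m) : dotv (x - y) z = dotv x z - dotv y z.
Proof. by rewrite -scaleN1r dotvDl dotvZl mulN1r. Qed.

Lemma dotvDr m (x y z : 'cV[R]_m) : dotv z (x + y) = dotv z x + dotv z y.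
Proof. by rewrite dotvC dotvDl !(dotvC z). Qed.

Lemma dotvZr m a (x z : 'cV[R]_m) : dotv z (a *: x) = a * dotv z x.
Proof. by rewrite dotvC dotvZl (dotvC z). Qed.

Lemma dotvBr m (x y z : 'cV[R]_m) : dotv z (x - y) = dotv z x - dotv z y.
Proof. by rewrite dotvC dotvBl !(dotvC z). Qed.

Lemma dotv_mull m n (M : 'M[R]_(m, n)) x y :
  dotv (M *m x) y = dotv x (M^T *m y).
Proof. by rewrite /dotv trmx_mul mulmxA. Qed.

Lemma dotv_ge0 m (x : 'cV[R]_m) : 0 <= dotv x x.
Proof. by rewrite dotvE sumr_ge0 // => i _; rewrite -expr2 sqr_ge0. Qed.

Lemma dotv_eq0 m (x : 'cV[R]_m) : dotv x x = 0 -> x = 0.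
Proof.
move=> x0; apply: trmx_inj; rewrite linear0; apply: mulmx_tr_eq0; rewrite trmxK.
by apply/matrixP => i j; rewrite !ord1 [RHS]mxE.
Qed.

Lemma sqr_vnorm2 m (x : 'cV[R]_m) : vnorm2 x ^+ 2 = dotv x x.
Proof. by rewrite sqr_sqrtr // dotv_ge0. Qed.

Lemma vnorm2_ge0 m (x : 'cV[R]_m) : 0 <= vnorm2 x.
Proof. exact: sqrtr_ge0. Qed.

Lemma vnorm20 m : vnorm2 (0 : 'cV[R]_m) = 0.
Proof. by rewrite /vnorm2 /dotv mulmx0 mxE sqrtr0. Qed.

Lemma vnorm2Z m a (x : 'cV[R]_m) : vnorm2 (a *: x) = `|a| * vnorm2 x.
Proof. by rewrite /vnorm2 dotvZl dotvZr mulrA -expr2 sqrtrM ?sqr_ge0 // sqrtr_sqr. Qed.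

Lemma vnorm2_le m (x : 'cV[R]_m) c : 0 <= c -> dotv x x <= c ^+ 2 -> vnorm2 x <= c.
Proof. by move=> c0 xc; rewrite -(@ler_pXn2r _ 2) ?nnegrE ?vnorm2_ge0 // sqr_vnorm2. Qed.

Lemma dotv_CauchySchwarz m (x y : 'cV[R]_m) :
  dotv x y ^+ 2 <= dotv x x * dotv y y.
Proof.
have [/dotv_eq0 ->|y0] := eqVneq (dotv y y) 0.
  by rewrite /dotv !mulmx0 mxE mulr0 expr0n.
have yp : 0 < dotv y y by rewrite lt_def y0 dotv_ge0.
have := dotv_ge0 (dotv y y *: x - dotv x y *: y).
rewrite dotvBl !dotvBr !dotvZl !dotvZr (dotvC y x).
have -> : dotv y y * (dotv y y * dotv x x) - dotv y y * (dotv x y * dotv x y) -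
   (dotv x y * (dotv y y * dotv x y) - dotv x y * (dotv x y * dotv y y)) =
   dotv y y * (dotv x x * dotv y y - dotv x y ^+ 2) by ring.
by rewrite pmulr_rge0 // subr_ge0.
Qed.

Lemma vnorm2_triangle m (x y : 'cV[R]_m) : vnorm2 (x - y) <= vnorm2 x + vnorm2 y.
Proof.
apply: vnorm2_le; first by rewrite addr_ge0 ?vnorm2_ge0.
have xy : - dotv x y <= vnorm2 x * vnorm2 y.
  rewrite (le_trans (ler_norm _)) // normrN.
  rewrite -(@ler_pXn2r _ 2) ?nnegrE ?mulr_ge0 ?vnorm2_ge0 //.
  by rewrite real_normK ?num_real // exprMn !sqr_vnorm2 dotv_CauchySchwarz.
rewrite dotvBl !dotvBr (dotvC y x) sqrrD !sqr_vnorm2; lra.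
Qed.

(** Cauchy-Schwarz applied row by row. The Frobenius bound makes the supremum in [mnorm2] finite and
    later estimates [Delta Sigma_k]. *)
Lemma dotv_mul_frobenius m n (M : 'M[R]_(m, n)) x :
  dotv (M *m x) (M *m x) <= (\sum_i \sum_j M i j ^+ 2) * dotv x x.
Proof.
rewrite [leLHS]dotvE mulr_suml; apply: ler_sum => i _.
have -> : (M *m x) i 0 = dotv (row i M)^T x.
  by rewrite /dotv trmxK -row_mul [RHS]mxE.
rewrite -expr2; apply: le_trans (dotv_CauchySchwarz _ _) _.
rewrite ler_wpM2r ?dotv_ge0 // dotvE le_eqVlt; apply/orP; left; apply/eqP.
by apply: eq_bigr => j _; rewrite !mxE expr2.
Qed.

Local Open Scope classical_set_scope.

Lemma mnorm2_has_sup m n (M : 'M[R]_(m, n)) :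
  has_sup [set vnorm2 (M *m x) | x in [set x : 'cV[R]_n | vnorm2 x <= 1]].
Proof.
split; first by exists (vnorm2 (M *m 0)), 0 => //=; rewrite vnorm20 ler01.
exists (Num.sqrt (\sum_i \sum_j M i j ^+ 2)) => _ [x /= x1 <-].
apply: ler_wsqrtr; apply: le_trans (dotv_mul_frobenius _ _) _.
rewrite ler_piMr //; last by rewrite -sqr_vnorm2 expr_le1 // vnorm2_ge0.
by rewrite sumr_ge0 // => i _; rewrite sumr_ge0 // => j _; rewrite sqr_ge0.
Qed.

Lemma mnorm2_mul m n (M : 'M[R]_(m, n)) x : vnorm2 (M *m x) <= mnorm2 M * vnorm2 x.
Proof.
have [x0|x0] := eqVneq (vnorm2 x) 0.
  rewrite x0 mulr0 (dotv_eq0 (x := x)) ?mulmx0 ?vnorm20 //.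
  by rewrite -sqr_vnorm2 x0 expr0n.
have xp : 0 < vnorm2 x by rewrite lt_def x0 vnorm2_ge0.
rewrite -ler_pdivrMr // mulrC -[_^-1]ger0_norm ?invr_ge0 ?vnorm2_ge0 //.
rewrite -vnorm2Z scalemxAr; apply: ub_le_sup; first exact: (mnorm2_has_sup M).2.
exists ((vnorm2 x)^-1 *: x) => //=.
by rewrite vnorm2Z ger0_norm ?invr_ge0 ?vnorm2_ge0 // mulVf.
Qed.

Lemma mnorm2_le m n (M : 'M[R]_(m, n)) c : 0 <= c ->
  (forall x, dotv (M *m x) (M *m x) <= c ^+ 2 * dotv x x) -> mnorm2 M <= c.
Proof.
move=> c0 Mc; apply: sup_le_ub => [|_ [x /= x1 <-]]; first exact: (mnorm2_has_sup M).1.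
apply: vnorm2_le => //; apply: le_trans (Mc x) _.
by rewrite ler_piMr ?sqr_ge0 // -sqr_vnorm2 expr_le1 // vnorm2_ge0.
Qed.

End EuclideanNorm.

(** * Lanczos bidiagonalization *)

Section Lanczos.
Variables (R : realType) (m n : nat) (A : 'M[R]_(m, n)) (b : 'cV[R]_m) (N : nat).
Variables (alpha beta : nat -> R) (p : nat -> 'cV[R]_m) (q : nat -> 'cV[R]_n).
Hypothesis hlan : lanczos_bidiag A b N alpha beta p q.

Lemma cols_mx_trmul d (x : nat -> 'cV[R]_d) k y i :
  ((cols_mx x k)^T *m y) i 0 = dotv (x i.+1) y.
Proof. by rewrite mxE dotvE; apply: eq_bigr => j _; rewrite !mxE. Qed.

Lemma cols_mx_gram d (x : nat -> 'cV[R]_d) k i j :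
  ((cols_mx x k)^T *m cols_mx x k) i j = dotv (x i.+1) (x j.+1).
Proof. by rewrite mxE dotvE; apply: eq_bigr => l _; rewrite !mxE. Qed.

Lemma lanczos_mulq i : (1 <= i < N)%N ->
  A *m q i = alpha i *: p i + beta i.+1 *: p i.+1.
Proof. by move=> hi; rewrite (lanczos_pS hlan) // addrC subrK. Qed.

Lemma lanczos_trmulp i : (1 <= i < N)%N ->
  A^T *m p i.+1 = beta i.+1 *: q i + alpha i.+1 *: q i.+1.
Proof. by move=> hi; rewrite (lanczos_qS hlan) // addrC subrK. Qed.

Lemma lanczos_dotvv i : (1 <= i <= N)%N -> dotv (p i) (p i) = 1 /\ dotv (q i) (q i) = 1.
Proof.
by move=> /(lanczos_unit hlan)[p1 q1]; rewrite -!sqr_vnorm2 p1 q1 expr1n.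
Qed.

(** The boolean factor merges the start, where [A^T p_1] has no [beta] term, with the general
    recurrence. *)
Lemma lanczos_dot_trmulp i y : (1 <= i <= N)%N ->
  dotv (A^T *m p i) y =
    alpha i * dotv (q i) y + (1 < i)%N%:R * (beta i * dotv (q i.-1) y).
Proof.
case: i => [//|[|i]] hi.
  by rewrite -(lanczos_q1 hlan) dotvZl mul0r addr0.
by rewrite lanczos_trmulp // dotvDl !dotvZl mul1r addrC.
Qed.

(** Both families go through one induction: orthogonality of the new [p] uses the old [q], and
    orthogonality of the new [q] uses the new [p]. *)
Lemma lanczos_orthonormal i j l :
  (i <= N)%N -> (1 <= j <= i)%N -> (1 <= l <= i)%N ->
  dotv (p j) (p l) = (j == l)%:R /\ dotv (q j) (q l) = (j == l)%:R.
Proof.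
elim: i j l => [j l _|i IH j l iN]; first lia.
have [-> {IH} hj hl|i0] := eqVneq i 0.
  have [-> ->] : j = 1%N /\ l = 1%N by lia.
  by apply: lanczos_dotvv; lia.
have {i0} hi : (1 <= i < N)%N by lia.
have IHp j' l' h h' := (IH j' l' (ltnW iN) h h').1.
have IHq j' l' h h' := (IH j' l' (ltnW iN) h h').2.
have [ai0 bi0] : 0 < alpha i.+1 /\ 0 < beta i.+1 by apply: (lanczos_pos hlan); lia.
(* Moving [A] to the other side gives [alpha_l (q_l, q_i) + beta_l (q_(l-1), q_i) - alpha_i (p_i,
   p_l)]. The middle term vanishes as [l - 1 < i], and the outer two cancel when [l = i]. *)
have pp l' : (1 <= l' <= i)%N -> dotv (p i.+1) (p l') = 0.
  move=> hl; apply: (mulfI (lt0r_neq0 bi0)); rewrite mulr0 -dotvZl.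
  rewrite (lanczos_pS hlan) // dotvBl dotvZl dotv_mull dotvC.
  rewrite lanczos_dot_trmulp; last lia.
  rewrite (IHp i l') ?(IHq l' i); try lia.
  have -> : (1 < l')%N%:R * (beta l' * dotv (q l'.-1) (q i)) = 0.
    by case: ltnP => h; rewrite ?mul0r // (IHq l'.-1 i); try lia;
       rewrite (_ : _ == _ = false) ?mulr0 //; lia.
  by rewrite addr0 (eq_sym i); case: eqP => [->|_]; rewrite ?mulr1 ?mulr0 subrr.
have qq l' : (1 <= l' <= i)%N -> dotv (q i.+1) (q l') = 0.
  move=> hl; apply: (mulfI (lt0r_neq0 ai0)); rewrite mulr0 -dotvZl.
  rewrite (lanczos_qS hlan) // dotvBl dotvZl dotv_mull trmxK.
  rewrite lanczos_mulq; last lia.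
  rewrite dotvDr !dotvZr pp // mulr0 add0r IHq //; last lia.
  have [<-|il] := eqVneq i l'.
    by rewrite (proj1 (lanczos_dotvv _)) ?subrr //; lia.
  by rewrite pp ?mulr0 ?subrr //; lia.
have [->|ji] := eqVneq j i.+1; have [->|li] := eqVneq l i.+1 => hj hl.
- by apply: lanczos_dotvv; lia.
- by rewrite pp ?qq //; lia.
- by rewrite (negbTE ji) dotvC pp ?(dotvC (q j)) ?qq //; lia.
- by apply: IH; lia.
Qed.

Lemma lanczos_cols_mx_orthonormal k : (k <= N)%N ->
  (cols_mx q k)^T *m cols_mx q k = 1%:M.
Proof.
move=> kN; apply/matrixP => i j; rewrite cols_mx_gram mxE.
by rewrite (proj2 (lanczos_orthonormal (i := N) _ _ _)) //; have := ltn_ord i; have := ltn_ord j; lia.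
Qed.

Lemma lanczos_mul_cols_mx k : (k < N)%N ->
  A *m cols_mx q k = cols_mx p k.+1 *m bidiag_mx alpha beta k.
Proof.
move=> kN; apply/matrixP => i j.
have -> : (A *m cols_mx q k) i j = (A *m q j.+1) i 0.
  by rewrite !mxE; apply: eq_bigr => l _; rewrite mxE.
have jk := ltn_ord j; rewrite lanczos_mulq; last lia.
(* Column [j] of the bidiagonal matrix is supported on rows [j] and [j+1]; these two terms are
   extracted from the sum. *)
rewrite !mxE (bigD1 (widen_ord (leqnSn k) j)) //= (bigD1 (lift ord0 j)) /=; last first.
  by rewrite -val_eqE /= /bump /=; lia.
rewrite !mxE /= eqxx /bump /= !add1n eqxx (_ : j.+1 == j = false); last lia.
rewrite big1 => [|l /andP[l1 l2]]; first by rewrite addr0 mulrC (mulrC (beta _)).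
move: l1 l2; rewrite !mxE -!val_eqE /= /bump /= !add1n => /negbTE -> /negbTE ->.
by rewrite mulr0.
Qed.

Lemma lanczos_approxE k : (k < N)%N ->
  lanczos_approx alpha beta p q k = A *m cols_mx q k *m (cols_mx q k)^T.
Proof. by move=> kN; rewrite /lanczos_approx -lanczos_mul_cols_mx. Qed.

End Lanczos.

(** * Singular value coordinates and Krylov spaces *)

Section SVD.
Variables (R : realType) (m n : nat) (A : 'M[R]_(m, n)).
Variables (u : nat -> 'cV[R]_m) (v : nat -> 'cV[R]_n) (sigma : nat -> R).
Hypothesis hsvd : simple_svd A u v sigma.

Lemma svd_lt i j : (1 <= i)%N -> (i < j)%N -> (j <= n)%N -> sigma j < sigma i.
Proof.
move=> i0; elim: j => // j IH; rewrite ltnS leq_eqVlt => /orP[/eqP<-|ij] jn.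
  by apply: (svd_simple hsvd); lia.
by apply: lt_trans (IH ij _); [apply: (svd_simple hsvd)|]; lia.
Qed.

Lemma svd_le i j : (1 <= i)%N -> (i <= j)%N -> (j <= n)%N -> sigma j <= sigma i.
Proof.
move=> i0; rewrite leq_eqVlt => /orP[/eqP-> //|ij jn].
exact: ltW (svd_lt i0 ij jn).
Qed.

Lemma svd_sqr_le i j : (1 <= i)%N -> (i <= j)%N -> (j <= n)%N ->
  sigma j ^+ 2 <= sigma i ^+ 2.
Proof.
move=> i0 ij jn; rewrite ler_pXn2r ?nnegrE ?(svd_le i0) // ltW //.
  by apply: (svd_pos hsvd); lia.
by apply: (svd_pos hsvd); lia.
Qed.

Hypothesis hmn : (n <= m)%N.

Local Notation U := (cols_mx u m).
Local Notation V := (cols_mx v n).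
Local Notation S := (rect_diag m n sigma).

Lemma rect_diag_trmul (y : 'cV[R]_m) (i : 'I_n) :
  (S^T *m y) i 0 = sigma i.+1 * y (widen_ord hmn i) 0.
Proof.
rewrite mxE (bigD1 (widen_ord hmn i)) //= !mxE eqxx big1 ?addr0 // => j ji.
rewrite !mxE; case: eqP => [e|]; last by rewrite mul0r.
by case/eqP: ji; apply: val_inj.
Qed.

Lemma rect_diag_mul (y : 'cV[R]_n) (i : 'I_n) :
  (S *m y) (widen_ord hmn i) 0 = sigma i.+1 * y i 0.
Proof.
rewrite mxE (bigD1 i) //= !mxE eqxx big1 ?addr0 // => j ji.
rewrite !mxE; case: eqP => [e|]; last by rewrite mul0r.
by case/eqP: ji; apply: val_inj.
Qed.

Lemma svd_rightK c (x : 'M[R]_(n, c)) : V *m (V^T *m x) = x.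
Proof. by rewrite mulmxA (mulmx1C (svd_right hsvd)) mul1mx. Qed.

Lemma svd_right_dotv (x y : 'cV[R]_n) : dotv (V^T *m x) (V^T *m y) = dotv x y.
Proof. by rewrite dotv_mull trmxK svd_rightK. Qed.

Lemma svd_trmul b (i : 'I_n) :
  (V^T *m (A^T *m b)) i 0 = sigma i.+1 * dotv (u i.+1) b.
Proof.
rewrite (svd_fact hsvd) !trmx_mul trmxK -!mulmxA (mulmxA V^T).
by rewrite (svd_right hsvd) mul1mx rect_diag_trmul cols_mx_trmul.
Qed.

Lemma svd_gram (x : 'cV[R]_n) (i : 'I_n) :
  (V^T *m (A^T *m (A *m x))) i 0 = sigma i.+1 ^+ 2 * (V^T *m x) i 0.
Proof.
rewrite {1}(svd_fact hsvd) !trmx_mul trmxK -!mulmxA (mulmxA V^T).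
rewrite (svd_right hsvd) mul1mx rect_diag_trmul (svd_fact hsvd) -!mulmxA.
by rewrite (mulmxA U^T) (svd_left hsvd) mul1mx rect_diag_mul mulrA.
Qed.

Lemma svd_dotv (x : 'cV[R]_n) :
  dotv (A *m x) (A *m x) = \sum_(i < n) sigma i.+1 ^+ 2 * (V^T *m x) i 0 ^+ 2.
Proof.
rewrite dotv_mull -svd_right_dotv dotvE; apply: eq_bigr => i _.
by rewrite svd_gram mulrCA expr2.
Qed.

Section Krylov.
Variables (b : 'cV[R]_m) (N : nat) (alpha beta : nat -> R).
Variables (p : nat -> 'cV[R]_m) (q : nat -> 'cV[R]_n).
Hypothesis hlan : lanczos_bidiag A b N alpha beta p q.

(* Membership of x in the j-th Krylov space, x = f(A^T A) A^T b, read off in the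
   coordinates of the right singular vectors. *)
Definition krylov j (x : 'cV[R]_n) := exists2 f : {poly R}, (size f <= j)%N &
  forall l : 'I_n,
    (V^T *m x) l 0 = f.[sigma l.+1 ^+ 2] * (sigma l.+1 * dotv (u l.+1) b).

Lemma krylov_comb j x y c d : krylov j x -> krylov j y -> krylov j (c *: x + d *: y).
Proof.
move=> [f fj fx] [g gj gy]; exists (c *: f + d *: g).
  rewrite (leq_trans (size_polyD _ _)) // geq_max.
  by rewrite !(leq_trans (size_scale_leq _ _)).
move=> l; rewrite linearP linearZ /= !mxE -!/(_ *m _).
by rewrite hornerD !hornerZ mulrDl -!mulrA -fx -gy !mxE.
Qed.

Lemma krylovZ j x c : krylov j x -> krylov j (c *: x).
Proof. by move=> Kx; rewrite -[c *: x]addr0 -(scale0r x); apply: krylov_comb. Qed.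

Lemma krylovS j x : krylov j x -> krylov j.+1 x.
Proof. by move=> [f fj fx]; exists f => //; apply: leqW. Qed.

Lemma krylov_mul j x : krylov j x -> krylov j.+1 (A^T *m (A *m x)).
Proof.
move=> [f fj fx]; exists ('X * f).
  by rewrite mulrC (leq_trans (size_polyMleq _ _)) // size_polyX addn2.
by move=> l; rewrite svd_gram fx hornerM hornerX mulrA.
Qed.

(** The recurrences feed each other, so [q_j] and [A^T p_j] are followed together. The degree grows
    only through [A^T A q_j], and the positive normalizing factors can be divided out. *)
Lemma krylov_lanczos j : (1 <= j <= N)%N -> krylov j (q j) /\ krylov j (A^T *m p j).
Proof.
elim: j => // -[_ N0|j IH jN].
  have [a0 b0] := lanczos_pos hlan N0.
  have Kb : krylov 1 (A^T *m b).
    by exists 1 => [|l]; rewrite ?size_poly1 // hornerC mul1r svd_trmul.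
  have Kp : krylov 1 (A^T *m p 1%N).
    rewrite -[A^T *m _]scale1r -(mulVf (lt0r_neq0 b0)) -scalerA scalemxAr.
    by rewrite (lanczos_p1 hlan); apply: krylovZ.
  split => //; rewrite -[q _]scale1r -(mulVf (lt0r_neq0 a0)) -scalerA.
  by rewrite (lanczos_q1 hlan); apply: krylovZ.
have [Kq Kp] : krylov j.+1 (q j.+1) /\ krylov j.+1 (A^T *m p j.+1) by apply: IH; lia.
have [a0 b0] := lanczos_pos hlan jN.
have Kp' : krylov j.+2 (A^T *m p j.+2).
  rewrite -[A^T *m _]scale1r -(mulVf (lt0r_neq0 b0)) -scalerA scalemxAr.
  rewrite (lanczos_pS hlan) // mulmxBr scalerBr -scalemxAr scalerA -scaleNr.
  by apply: krylov_comb; [apply: krylov_mul|apply: krylovS].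
split => //; rewrite -[q _]scale1r -(mulVf (lt0r_neq0 a0)) -scalerA.
rewrite (lanczos_qS hlan) // scalerBr scalerA -scaleNr.
by apply: krylov_comb => //; apply: krylovS.
Qed.

(** Column [c] of [F] holds the coefficients of the polynomial that produces [q_(c+1)]; the left
    factor is [D T_k]. *)
Lemma krylov_factor k : (k <= N)%N -> exists F : 'M[R]_k,
  V^T *m cols_mx q k = (\matrix_(i < n, j < k)
    (sigma i.+1 * dotv (u i.+1) b * sigma i.+1 ^+ (2 * j))) *m F.
Proof.
move=> kN; have /choice[f hf] : forall c : 'I_k, exists f : {poly R},
    (size f <= c.+1)%N /\ forall l : 'I_n, (V^T *m q c.+1) l 0 =
       f.[sigma l.+1 ^+ 2] * (sigma l.+1 * dotv (u l.+1) b).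
  move=> c; have [|[f f1 f2] _] := @krylov_lanczos c.+1; last by exists f.
  by have := ltn_ord c; lia.
exists (\matrix_(j, c) (f c)`_j); apply/matrixP => i c.
have -> : (V^T *m cols_mx q k) i c = (V^T *m q c.+1) i 0.
  by rewrite mxE [RHS]mxE; apply: eq_bigr => l _; rewrite !mxE.
have [fc ->] := hf c; rewrite mxE (@horner_coef_wide _ k); last first.
  by have := ltn_ord c; lia.
rewrite mulr_suml; apply: eq_bigr => j _.
by rewrite !mxE exprM mulrC -mulrA (mulrC (_ ^+ j)).
Qed.

End Krylov.
End SVD.

(** * The orthogonal complement of the range of (I; E) *)

Section Split.
Variables (R : realType) (n k : nat).
Hypothesis kn : (k <= n)%N.

Lemma bot_ord_subproof (i : 'I_(n - k)) : (k + i < n)%N.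
Proof. by rewrite -ltn_subRL. Qed.

Definition bot_ord (i : 'I_(n - k)) : 'I_n := Ordinal (bot_ord_subproof i).

Local Notation top := (rowsub (widen_ord kn)).
Local Notation bot := (rowsub bot_ord).

Lemma sum_split (F : 'I_n -> R) :
  \sum_i F i = \sum_i F (widen_ord kn i) + \sum_i F (bot_ord i).
Proof.
have e : (k + (n - k) = n)%N by rewrite subnKC.
rewrite (reindex (cast_ord e)) /=; last first.
  by exists (cast_ord (esym e)) => i _; apply: val_inj.
rewrite big_split_ord /=; congr (_ + _); apply: eq_bigr => i _;
  by congr F; apply: val_inj.
Qed.

Lemma mulmx_trl_split a c (M : 'M[R]_(n, a)) (N : 'M[R]_(n, c)) :
  M^T *m N = (top M)^T *m top N + (bot M)^T *m bot N.
Proof.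
apply/matrixP => i j; rewrite mxE [RHS]mxE sum_split !mxE.
by congr (_ + _); apply: eq_bigr => l _; rewrite !mxE.
Qed.

Lemma dotv_split (x y : 'cV[R]_n) :
  dotv x y = dotv (top x) (top y) + dotv (bot x) (bot y).
Proof. by rewrite /dotv mulmx_trl_split mxE. Qed.

Section OrthogonalComplement.
Variables (W : 'M[R]_(n, k)) (E : 'M[R]_(n - k, k)).
Hypothesis W1 : W^T *m W = 1%:M.
Hypothesis WE : bot W = E *m top W.

(** Splitting [W^T W = I] into blocks exhibits [top W] as an invertible square matrix, which also
    yields [G = top W (top W)^T] below. *)
Let gram1 : (top W)^T *m ((1%:M + E^T *m E) *m top W) = 1%:M.
Proof.
rewrite -[RHS]W1 mulmx_trl_split WE trmx_mul mulmxDl mul1mx mulmxDr.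
by rewrite -!mulmxA.
Qed.

Let invE : invmx (1%:M + E^T *m E) = top W *m (top W)^T.
Proof.
have := mulmx1C gram1; rewrite -mulmxA => /mulmx1C h.
have [_ u1] := mulmx1_unit h.
by rewrite -[RHS](mulmxK u1) h mul1mx.
Qed.

Variable y : 'cV[R]_n.
Let z := y - W *m (W^T *m y).

(** Pythagoras: the squared norm of [z] is that of [y] minus that of [W^T y]. *)
Lemma compl_dotv_le : dotv z z <= dotv y y.
Proof.
rewrite /z dotvBl !dotvBr (dotvC y (W *m _)) !dotv_mull (mulmxA W^T) W1 mul1mx.
have := dotv_ge0 (W^T *m y); rewrite dotv_mull; lra.
Qed.

(* z is orthogonal to the range of (I; E), so its top block is determined by its
   bottom block. *)
Lemma compl_top : top z = - (E^T *m bot z).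
Proof.
have : W^T *m z = 0 by rewrite /z mulmxBr (mulmxA W^T W) W1 mul1mx subrr.
rewrite mulmx_trl_split WE trmx_mul -mulmxA -mulmxDr => h.
have [u1 _] := mulmx1_unit gram1.
by apply/eqP; rewrite -addr_eq0 -[X in X == _](mulKmx u1) h mulmx0.
Qed.

Lemma compl_topE : let G := invmx (1%:M + E^T *m E) in
  top z = G *m E^T *m E *m top y - G *m E^T *m bot y.
Proof.
move=> /=; have u1 : 1%:M + E^T *m E \in unitmx.
  have := mulmx1C gram1; rewrite -mulmxA => /mulmx1_unit[] //.
have -> : top z = top y - top W *m (W^T *m y).
  by rewrite mul_rowsub_mx; apply/matrixP => i j; rewrite !mxE.
rewrite mulmx_trl_split WE mulmxDr trmx_mul mulmxA -invE.
rewrite -(mulmxA (top W)^T) (mulmxA (top W)) -invE.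
(* Writing [top y] as [G (I + E^T E) top y] cancels the plain [G top y] and leaves the term with
   [E^T E]. *)
rewrite -{1}[top y](mulKmx u1) mulmxDl mul1mx mulmxDr opprD addrA.
by rewrite [X in X - _ = _]addrAC subrr add0r !mulmxA.
Qed.

Lemma compl_top_dotv_le d (M : 'M[R]_(d, k)) :
  let G := invmx (1%:M + E^T *m E) in
  dotv (M *m top z) (M *m top z) <=
    (mnorm2 (M *m G *m E^T *m E) ^+ 2 + mnorm2 (M *m G *m E^T) ^+ 2) * dotv y y.
Proof.
move=> /=; set G := invmx _; rewrite compl_topE -/G mulmxBr !mulmxA.
set N := M *m G *m E^T *m E; set N' := M *m G *m E^T.
set y1 := top y; set y2 := bot y.
have -> : dotv y y = vnorm2 y1 ^+ 2 + vnorm2 y2 ^+ 2.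
  by rewrite !sqr_vnorm2 -dotv_split.
rewrite -sqr_vnorm2.
have tri := vnorm2_triangle (N *m y1) (N' *m y2).
have h1 := mnorm2_mul N y1; have h2 := mnorm2_mul N' y2.
have h : vnorm2 (N *m y1 - N' *m y2) <=
    mnorm2 N * vnorm2 y1 + mnorm2 N' * vnorm2 y2 by lra.
apply: le_trans (lerXn2r 2 _ _ h) _; rewrite ?nnegrE ?vnorm2_ge0 //.
  exact: le_trans (vnorm2_ge0 _) h.
(* This square is exactly the gap in the two-dimensional Cauchy-Schwarz inequality for the two norms
   and the two blocks of [y]. *)
have := sqr_ge0 (mnorm2 N * vnorm2 y2 - mnorm2 N' * vnorm2 y1); nra.
Qed.

End OrthogonalComplement.

Lemma krylov_vdm_unitmx (sigma : nat -> R) :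
  (forall i j, (1 <= i)%N -> (i < j)%N -> (j <= n)%N -> sigma j < sigma i) ->
  (forall i, (1 <= i <= n)%N -> 0 < sigma i) ->
  krylov_vdm sigma k 0 k \in unitmx.
Proof.
move=> slt s0.
have -> : krylov_vdm sigma k 0 k = (Vandermonde k (\row_i sigma i.+1 ^+ 2))^T.
  by apply/matrixP => i j; rewrite !mxE add0n exprM.
rewrite unitmx_tr unitmxE unitfE det_Vandermonde; apply/prodf_neq0 => i _.
apply/prodf_neq0 => j ij; rewrite !mxE subr_eq0.
have jk := ltn_ord j.
have ltij : sigma j.+1 < sigma i.+1 by apply: slt; lia.
rewrite lt_eqF // ltr_pXn2r // nnegrE ltW // s0; lia.
Qed.

(** With [W = D T_k F], the factors [T_k1^-1 D_1^-1] cancel against [top W = D_1 T_k1 F], leaving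
    [D_2 T_k2 F]. Invertibility of [F] does not enter. *)
Lemma krylov_Delta_split m (u : nat -> 'cV[R]_m) (sigma : nat -> R) b (F : 'M[R]_k) :
  (forall i j, (1 <= i)%N -> (i < j)%N -> (j <= n)%N -> sigma j < sigma i) ->
  (forall i, (1 <= i <= n)%N -> 0 < sigma i) ->
  (forall i, (1 <= i <= n)%N -> dotv (u i) b != 0) ->
  let W := (\matrix_(i < n, j < k)
    (sigma i.+1 * dotv (u i.+1) b * sigma i.+1 ^+ (2 * j))) *m F in
  bot W = krylov_Delta n u sigma b k *m top W.
Proof.
move=> slt s0 ub0 W; rewrite /W -!mul_rowsub_mx mulmxA; congr (_ *m F).
set d := fun j => sigma j * dotv (u j) b.
have -> : top (\matrix_(i < n, j < k)
    (sigma i.+1 * dotv (u i.+1) b * sigma i.+1 ^+ (2 * j))) =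
    diag_block d 0 k *m krylov_vdm sigma k 0 k.
  by apply/matrixP => i j; rewrite /diag_block mul_diag_mx !mxE /= !add0n.
have -> : bot (\matrix_(i < n, j < k)
    (sigma i.+1 * dotv (u i.+1) b * sigma i.+1 ^+ (2 * j))) =
    diag_block d k (n - k) *m krylov_vdm sigma k k (n - k).
  by apply/matrixP => i j; rewrite /diag_block mul_diag_mx !mxE.
have uD : diag_block d 0 k \in unitmx.
  rewrite unitmxE unitfE det_diag; apply/prodf_neq0 => i _; rewrite mxE add0n.
  have ik := ltn_ord i.
  by rewrite mulf_neq0 ?ub0 ?lt0r_neq0 ?s0 //; lia.
have uT := krylov_vdm_unitmx slt s0.
by rewrite /krylov_Delta -/d !mulmxA (mulmxKV uD) (mulmxKV uT).
Qed.

End Split.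

(** * Bounds on gamma_k *)

Section ResidualNorm.
Variables (R : realType) (m n : nat) (A : 'M[R]_(m, n)).
Variables (u : nat -> 'cV[R]_m) (v : nat -> 'cV[R]_n) (sigma : nat -> R).
Hypothesis hmn : (n <= m)%N.
Hypothesis hsvd : simple_svd A u v sigma.
Variables (b : 'cV[R]_m) (alpha beta : nat -> R).
Variables (p : nat -> 'cV[R]_m) (q : nat -> 'cV[R]_n).
Hypothesis hub : forall i, (1 <= i <= n)%N -> dotv (u i) b != 0.
Hypothesis hlan : lanczos_bidiag A b n alpha beta p q.
Variable k : nat.
Hypothesis kn : (k < n)%N.

Local Notation V := (cols_mx v n).
Local Notation Q := (cols_mx q k).
Local Notation X := (lanczos_approx alpha beta p q k).
Local Notation top := (rowsub (widen_ord (ltnW kn))).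
Local Notation bot := (rowsub (@bot_ord n k)).
Local Notation Sk := (diag_block sigma 0 k).
Local Notation E := (krylov_Delta n u sigma b k).
Let W := V^T *m Q.
Let z (x : 'cV[R]_n) := V^T *m x - W *m (W^T *m (V^T *m x)).

Let W1 : W^T *m W = 1%:M.
Proof.
rewrite /W trmx_mul trmxK -mulmxA (svd_rightK hsvd).
by rewrite (lanczos_cols_mx_orthonormal hlan) // ltnW.
Qed.

Let WE : bot W = E *m top W.
Proof.
have [F WF] := krylov_factor hsvd hmn hlan (ltnW kn).
rewrite /W WF; apply: krylov_Delta_split => //; last exact: svd_pos hsvd.
by move=> i j; apply: (svd_lt hsvd).
Qed.

Lemma residual_mul (x : 'cV[R]_n) : (A - X) *m x = A *m (x - Q *m (Q^T *m x)).
Proof. by rewrite (lanczos_approxE hlan) // mulmxBl mulmxBr !mulmxA. Qed.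

Let residual_coord x : V^T *m (x - Q *m (Q^T *m x)) = z x.
Proof.
by rewrite /z mulmxBr /W trmx_mul trmxK -!mulmxA (svd_rightK hsvd).
Qed.

(** In singular coordinates [A] only scales; the singular values of the bottom block are all
    replaced by their largest, [sigma_(k+1)]. *)
Lemma residual_dotv_le x : dotv ((A - X) *m x) ((A - X) *m x) <=
  dotv (Sk *m top (z x)) (Sk *m top (z x)) +
  sigma k.+1 ^+ 2 * dotv (bot (z x)) (bot (z x)).
Proof.
rewrite residual_mul (svd_dotv hsvd hmn) residual_coord (sum_split (ltnW kn)).
apply: lerD; rewrite !dotvE.
  rewrite le_eqVlt; apply/orP; left; apply/eqP; apply: eq_bigr => i _.
  by rewrite /diag_block mul_diag_mx !mxE add0n /=; ring.
rewrite mulr_sumr; apply: ler_sum => i _; rewrite !mxE /= -expr2.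
have ik := ltn_ord i; apply: ler_wpM2r; first exact: sqr_ge0.
by apply: (svd_sqr_le hsvd) => //; lia.
Qed.

Let dotv_z_le x : dotv (z x) (z x) <= dotv x x.
Proof. by rewrite -[leRHS](svd_right_dotv hsvd); apply: compl_dotv_le. Qed.

Lemma residual_norm_le_Delta c :
  (forall w, dotv (Sk *m E^T *m w) (Sk *m E^T *m w) <= c ^+ 2 * dotv w w) ->
  mnorm2 (A - X) <= Num.sqrt (sigma k.+1 ^+ 2 + c ^+ 2).
Proof.
move=> hc; apply: mnorm2_le => [|x]; first exact: sqrtr_ge0.
rewrite sqr_sqrtr ?addr_ge0 ?sqr_ge0 //; apply: le_trans (residual_dotv_le x) _.
have -> : top (z x) = - (E^T *m bot (z x)) by apply: compl_top.
rewrite mulmxN -scaleN1r dotvZl dotvZr mulrA mulrNN !mul1r mulmxA.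
apply: le_trans (lerD (hc _) (lexx _)) _; rewrite -mulrDl addrC.
apply: ler_wpM2l; first by rewrite addr_ge0 ?sqr_ge0.
apply: le_trans (dotv_z_le x); rewrite (dotv_split (ltnW kn)).
by have := dotv_ge0 (top (z x)); lra.
Qed.

Lemma residual_norm_le_eps :
  mnorm2 (A - X) <= Num.sqrt (sigma k.+1 ^+ 2 + krylov_eps n u sigma b k ^+ 2).
Proof.
apply: mnorm2_le => [|x]; first exact: sqrtr_ge0.
rewrite sqr_sqrtr ?addr_ge0 ?sqr_ge0 //; apply: le_trans (residual_dotv_le x) _.
rewrite addrC mulrDl; apply: lerD.
  apply: ler_wpM2l; first exact: sqr_ge0.
  apply: le_trans (dotv_z_le x); rewrite (dotv_split (ltnW kn)).
  by have := dotv_ge0 (top (z x)); lra.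
rewrite /krylov_eps sqr_sqrtr ?addr_ge0 ?sqr_ge0 //.
by rewrite -(svd_right_dotv hsvd x x); apply: compl_top_dotv_le.
Qed.

Lemma sigma_le_residual_norm : sigma k.+1 <= mnorm2 (A - X).
Proof.
pose f : 'I_k.+1 -> 'I_n := widen_ord kn.
(* The first [k+1] rows of [W] lie in a space of dimension [k], hence are linearly dependent; [c]
   collects the coefficients of a dependence. *)
have [c cW c0] : exists2 c : 'rV_k.+1, c *m rowsub f W = 0 & c != 0.
  have : kermx (rowsub f W) != 0.
    rewrite kermx_eq0 /row_free neq_ltn.
    by rewrite (leq_ltn_trans (rank_leq_col _)).
  by case/rowV0Pn => c /sub_kermxP cW c0; exists c.
(* [y] is [c] padded by zeros: [V y] lies in the span of [v_1, ..., v_(k+1)] and is orthogonal to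
   the Krylov basis. *)
pose y : 'cV[R]_n := (c *m rowsub f 1%:M)^T.
have yW : W^T *m y = 0.
  by rewrite -trmx_mul -mulmxA mul_rowsub_mx mul1mx cW trmx0.
have yE i : y i 0 = \sum_j c 0 j * (f j == i)%:R.
  by rewrite !mxE; apply: eq_bigr => j _; rewrite !mxE.
have yf j : y (f j) 0 = c 0 j.
  rewrite yE (bigD1 j) //= eqxx mulr1 big1 ?addr0 // => l lj.
  have -> : (f l == f j) = (l == j) by [].
  by rewrite (negbTE lj) mulr0.
have y0 (i : 'I_n) : (k < i)%N -> y i 0 = 0.
  move=> ki; rewrite yE big1 // => j _.
  have -> : (f j == i) = false by rewrite -val_eqE /=; have := ltn_ord j; lia.
  by rewrite mulr0.
have yn0 : y != 0.
  apply: contra c0 => /eqP y0'; apply/eqP/matrixP => i j.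
  by rewrite ord1 -yf y0' !mxE.
have Vy : V^T *m (V *m y) = y by rewrite mulmxA (svd_right hsvd) mul1mx.
have yp : 0 < vnorm2 y.
  rewrite lt_def vnorm2_ge0 andbT; apply: contra yn0 => /eqP h.
  by rewrite (dotv_eq0 (x := y)) // -sqr_vnorm2 h expr0n.
rewrite -(ler_pM2r yp).
have -> : vnorm2 y = vnorm2 (V *m y).
  by rewrite /vnorm2 -(svd_right_dotv hsvd (V *m y)) Vy.
apply: le_trans (mnorm2_mul _ _).
have s0 : 0 < sigma k.+1 by apply: (svd_pos hsvd); lia.
rewrite -(@ler_pXn2r _ 2) ?nnegrE ?mulr_ge0 ?vnorm2_ge0 ?(ltW s0) //.
rewrite exprMn !sqr_vnorm2 -(svd_right_dotv hsvd (V *m y)) residual_mul.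
rewrite (svd_dotv hsvd hmn) residual_coord /z Vy yW mulmx0 subr0 dotvE mulr_sumr.
apply: ler_sum => i _; rewrite -expr2.
have [ki|ik] := ltnP k i; first by rewrite (y0 i) // expr0n !mulr0.
apply: ler_wpM2r; first exact: sqr_ge0.
by have jn := ltn_ord i; apply: (svd_sqr_le hsvd) => //; lia.
Qed.

End ResidualNorm.

(** * Geometrically decaying singular values *)

Section GeometricDecay.
Variable R : realType.

(** Weierstrass product inequality; the induction also carries that the product stays in
    [[0, 1]]. *)
Lemma prod_1B_ge (I : finType) (P : pred I) (x : I -> R) :
  (forall i, 0 <= x i <= 1) -> 1 - \sum_(i | P i) x i <= \prod_(i | P i) (1 - x i).
Proof.
move=> x01; suff [] : 1 - \sum_(i | P i) x i <= \prod_(i | P i) (1 - x i) /\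
  0 <= \prod_(i | P i) (1 - x i) <= 1 by [].
elim/big_rec2: _ => [|i s t _ [st /andP[t0 t1]]]; first by rewrite subr0 lexx ler01.
have /andP[xi0 xi1] := x01 i; split; first by nra.
by apply/andP; split; nra.
Qed.

(** The constant is the full geometric series at [t = 1/4], a fixed point of the induction step:
    [1 + 1/4 * 4/3 = 4/3]. *)
Lemma sum_expr_le (t : R) N : 0 <= t <= 1 / 4 -> \sum_(i < N) t ^+ i <= 4 / 3.
Proof.
move=> /andP[t0 t4]; elim: N => [|N IH]; first by rewrite big_ord0; lra.
rewrite big_ord_recl expr0.
under eq_bigr do rewrite exprS.
by rewrite -mulr_sumr; nra.
Qed.

Lemma sum_exprB_le (t : R) k : 0 <= t <= 1 / 4 -> \sum_(c < k) t ^+ (k - c) <= 1 / 3.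
Proof.
move=> t4; rewrite (reindex_inj rev_ord_inj) /=.
under eq_bigr => i _ do rewrite subKn // exprS.
rewrite -mulr_sumr; have := sum_expr_le k t4; have := t4 => /andP[t0 t1]; nra.
Qed.

(** * Lagrange interpolation at the squared singular values *)

Section Lagrange.
Variables (n k : nat) (sigma : nat -> R).
Hypothesis kn : (k < n)%N.
Hypothesis slt :
  forall i j, (1 <= i)%N -> (i < j)%N -> (j <= n)%N -> sigma j < sigma i.
Hypothesis s0 : forall i, (1 <= i <= n)%N -> 0 < sigma i.

Local Notation E := (krylov_vdm sigma k k (n - k) *m invmx (krylov_vdm sigma k 0 k)).

(** Because [E T_k1 = T_k2], the identity holds for monomials of degree below [k]: row [i] of [E]
    extrapolates from the first [k] nodes to a later one. *)
Lemma krylov_vdm_interpolation (f : {poly R}) i : (size f <= k)%N ->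
  \sum_c E i c * f.[sigma c.+1 ^+ 2] = f.[sigma (k + i).+1 ^+ 2].
Proof.
move=> fk; have uT := krylov_vdm_unitmx (ltnW kn) slt s0.
have /matrixP h := mulmxKV uT (krylov_vdm sigma k k (n - k)).
rewrite [RHS](horner_coef_wide _ fk).
under eq_bigr => c _ do rewrite (horner_coef_wide _ fk) mulr_sumr.
rewrite exchange_big /=; apply: eq_bigr => j _.
rewrite -exprM; have := h i j; rewrite mxE [RHS]mxE => <-.
rewrite mulr_sumr; apply: eq_bigr => c _; rewrite [krylov_vdm _ _ _ _ c j]mxE.
by rewrite add0n exprM mulrCA.
Qed.

(** Interpolation is applied to the polynomial vanishing at every node except the one of index [c].
    The multiplied-out form avoids dividing by node differences. *)
Lemma lagrange_entry i c :
  E i c * \prod_(l < k | l != c) (sigma c.+1 ^+ 2 - sigma l.+1 ^+ 2) =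
  \prod_(l < k | l != c) (sigma (k + i).+1 ^+ 2 - sigma l.+1 ^+ 2).
Proof.
pose f : {poly R} := \prod_(l < k | l != c) ('X - (sigma l.+1 ^+ 2)%:P).
have fE x : f.[x] = \prod_(l < k | l != c) (x - sigma l.+1 ^+ 2).
  by rewrite horner_prod; apply: eq_bigr => l _; rewrite hornerXsubC.
have fk : (size f <= k)%N.
  rewrite /f -big_filter size_prod_XsubC size_filter -sum1_count.
  by rewrite sum1_card cardC1 card_ord prednK // (leq_ltn_trans _ (ltn_ord c)).
rewrite -!fE -krylov_vdm_interpolation // [RHS](bigD1 c) //= [X in _ + X]big1 ?addr0 //.
move=> l lc; rewrite fE (bigD1 l) //= subrr mul0r mulr0 //.
Qed.

End Lagrange.

(** * Bounds on the interpolation weights and on [Delta_k] under geometric decay *)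

Section GeometricSingularValues.
Variables (n k : nat) (sigma : nat -> R) (zeta s : R).
Hypothesis kn : (k < n)%N.
Hypothesis slt :
  forall i j, (1 <= i)%N -> (i < j)%N -> (j <= n)%N -> sigma j < sigma i.
Hypothesis s0 : forall i, (1 <= i <= n)%N -> 0 < sigma i.
Hypothesis s_le : 0 < s <= 1 / 2.
Hypothesis sE : forall i, (1 <= i <= n)%N -> sigma i = zeta * s ^+ i.

Local Notation E := (krylov_vdm sigma k k (n - k) *m invmx (krylov_vdm sigma k 0 k)).

Let sigma_shift i j : (1 <= i)%N -> (i <= j)%N -> (j <= n)%N ->
  sigma j = sigma i * s ^+ (j - i).
Proof.
move=> i0 ij jn; rewrite (@sE j) ?(@sE i) -?mulrA -?exprD ?subnKC //; lia.
Qed.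

Let t_le : 0 <= s ^+ 2 <= 1 / 4.
Proof. by have /andP[h0 h1] := s_le; rewrite sqr_ge0 /=; nra. Qed.

Lemma lagrange_entry_le i c : `|E i c| <= 3 / 2.
Proof.
have ck := ltn_ord c; have ik := ltn_ord i.
have idx (l : 'I_k) : (1 <= l.+1 <= n)%N by have := ltn_ord l; lia.
have le_n (l : 'I_k) : (l.+1 <= n)%N by have := ltn_ord l; lia.
have lt_kil (l : 'I_k) : (l.+1 < (k + i).+1 <= n)%N by have := ltn_ord l; lia.
have idx_ki : (1 <= (k + i).+1 <= n)%N by lia.
pose a l := sigma l ^+ 2.
have a0 l : (1 <= l <= n)%N -> 0 < a l by move=> /s0 h; rewrite exprn_gt0.
have a_shift i' j : (1 <= i')%N -> (i' <= j)%N -> (j <= n)%N ->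
    a j = a i' * (s ^+ 2) ^+ (j - i').
  by move=> h1 h2 h3; rewrite /a (sigma_shift h1 h2 h3) exprMn exprAC.
set P := \prod_(l < k | l != c) a l.+1.
have P0 : 0 < P by apply: prodr_gt0 => l _; exact: a0.
have := lagrange_entry kn slt s0 i c => /(congr1 Num.norm).
rewrite normrM !normr_prod => h.
(* Each numerator factor is at most [a_l], since [a_(k+i)] lies between 0 and [a_l]. *)
have h1 : `|E i c| * \prod_(l < k | l != c) `|a c.+1 - a l.+1| <= P.
  rewrite h; apply: ler_prod => l _; rewrite normr_ge0 /=.
  have /andP[lki kin] := lt_kil l.
  rewrite distrC ger0_norm; first by rewrite gerBl sqr_ge0.
  rewrite subr_ge0 ler_pXn2r ?nnegrE ?ltW //; by [apply: slt|apply: s0].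
(* |a_c - a_l| is at least a_l if l > c, and equals a_l (1 - s^(2 (c - l))) if
   l < c. *)
pose x (l : 'I_k) := if (l < c)%N then (s ^+ 2) ^+ (c - l) else 0.
have x01 l : 0 <= x l <= 1.
  rewrite /x; case: ifP => _; last by rewrite lexx ler01.
  have /andP[t0 t1] := t_le.
  by rewrite exprn_ge0 //= exprn_ile1 //; lra.
(* The exponents [c - l] are distinct and positive, so the sum is part of a geometric series of
   ratio [s^2 <= 1/4]. *)
have sx : \sum_(l < k | l != c) x l <= 1 / 3.
  apply: le_trans (sum_exprB_le c t_le).
  rewrite (big_ord_widen k (fun l => (s ^+ 2) ^+ (c - l))) 1?ltnW //.
  rewrite [leRHS]big_mkcond [leLHS]big_mkcond; apply: ler_sum => l _; rewrite /x.
  have /andP[t0 _] := t_le.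
  by case: ifP => _; case: ifP => _ //; rewrite exprn_ge0.
have h2 : 2 / 3 * P <= \prod_(l < k | l != c) `|a c.+1 - a l.+1|.
  have -> : 2 / 3 * P = P * (2 / 3) by rewrite mulrC.
  apply: le_trans (_ : P * \prod_(l < k | l != c) (1 - x l) <= _).
    by rewrite ler_pM2l //; apply: le_trans (prod_1B_ge _ x01); lra.
  rewrite -big_split /=; apply: ler_prod => l lc.
  have /andP[x0 x1] := x01 l.
  have al0 : 0 < a l.+1 by exact: a0.
  rewrite mulr_ge0 ?subr_ge0 ?(ltW al0) //=.
  rewrite /x; case: ltnP => cl.
    rewrite (@a_shift l.+1 c.+1) //; last exact: ltnW cl.
    by rewrite subSS distrC mulrBr mulr1 ler_norm.
  have {}cl : (c < l)%N by rewrite ltn_neqAle cl eq_sym (inj_eq val_inj) lc.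
  apply: le_trans (ler_norm _).
  have ac0 : 0 < a c.+1 by exact: a0.
  rewrite (@a_shift c.+1 l.+1) //; last exact: ltnW cl.
  (* After division by [a_c] the claim is [2 (s^2)^(l - c) <= 1]; one factor [s^2 <= 1/4] is
     enough. *)
  rewrite subSS subr0 mulr1 lerBrDr -mulrDr -[leRHS]mulr1 ler_pM2l //.
  rewrite -(@prednK (l - c)) ?subn_gt0 //.
  have /andP[t0 t1] := t_le; rewrite exprS.
  have : (s ^+ 2) ^+ (l - c).-1 <= 1 by rewrite exprn_ile1 //; lra.
  have : 0 <= (s ^+ 2) ^+ (l - c).-1 by exact: exprn_ge0.
  nra.
have n0 := normr_ge0 (E i c); rewrite -(ler_pM2r P0); nra.
Qed.

Lemma krylov_Delta_geometric m (u : nat -> 'cV[R]_m) b :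
  (forall i, (1 <= i <= n)%N -> dotv (u i) b != 0) ->
  (forall c j, (1 <= c <= k)%N -> (k < j <= n)%N ->
     `|dotv (u j) b| * sigma c <= sigma k.+1 * `|dotv (u c) b|) ->
  let M := diag_block sigma 0 k *m (krylov_Delta n u sigma b k)^T in
  forall w, dotv (M *m w) (M *m w) <= sigma k.+1 ^+ 2 * dotv w w.
Proof.
move=> ub0 hdec M w; apply: le_trans (dotv_mul_frobenius _ _) _.
apply: ler_wpM2r; first exact: dotv_ge0.
set d := fun j => sigma j * dotv (u j) b.
have uD : diag_block d 0 k \in unitmx.
  rewrite unitmxE unitfE det_diag; apply/prodf_neq0 => i _; rewrite mxE add0n.
  have ik := ltn_ord i.
  by rewrite mulf_neq0 ?ub0 ?lt0r_neq0 ?s0 //; lia.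
(* Multiplying by [D_1] gives the entries of [Delta_k] without its inverse. *)
have DE (c : 'I_k) (i : 'I_(n - k)) :
    krylov_Delta n u sigma b k i c * d c.+1 = d (k + i).+1 * E i c.
  have : krylov_Delta n u sigma b k *m diag_block d 0 k =
      diag_block d k (n - k) *m E.
    by rewrite /krylov_Delta -/d (mulmxKV uD) mulmxA.
  by move=> /matrixP/(_ i c); rewrite /diag_block mul_mx_diag mul_diag_mx !mxE add0n.
have Mle (c : 'I_k) i : M c i ^+ 2 <=
    9 / 4 * sigma k.+1 ^+ 2 * (s ^+ 2) ^+ i * (s ^+ 2) ^+ (k - c).
  have ck := ltn_ord c; have ik := ltn_ord i.
  have [cn ki] : (c.+1 <= n)%N /\ (k < (k + i).+1 <= n)%N by lia.
  have kin := (andP ki).2.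
  have sc0 : 0 < sigma c.+1 by exact: s0.
  have sk0 : 0 < sigma k.+1 by exact: s0.
  have sj0 : 0 < sigma (k + i).+1 by exact: s0.
  have uc0 : 0 < `|dotv (u c.+1) b| by rewrite normr_gt0 ub0.
  have -> : M c i = sigma c.+1 * krylov_Delta n u sigma b k i c.
    by rewrite /M /diag_block mul_diag_mx !mxE add0n.
  set e := krylov_Delta _ _ _ _ _ _ _.
  (* By [DE], [sigma_c |e|] equals [sigma_j |E| |u_j^T b| / |u_c^T b|]. The decay hypothesis bounds
     the quotient by [sigma_(k+1) / sigma_c = s^(k-c)], and [sigma_j = sigma_(k+1) s^i], with
     one-based indices [j] and [c]. *)
  have h : `|sigma c.+1 * e| <= 3 / 2 * (sigma k.+1 * s ^+ i * s ^+ (k - c)).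
    have := DE c i => /(congr1 Num.norm); rewrite -/e /d !normrM.
    rewrite !(gtr0_norm sc0) (gtr0_norm sj0) => h.
    have hE := lagrange_entry_le i c.
    have hd : `|dotv (u (k + i).+1) b| * sigma c.+1 <= sigma k.+1 * `|dotv (u c.+1) b|.
      exact: hdec.
    have -> : sigma k.+1 * s ^+ i = sigma (k + i).+1.
      by rewrite (@sigma_shift k.+1 (k + i).+1) ?subSS ?addKn // ltnS leq_addr.
    have shk : sigma k.+1 = sigma c.+1 * s ^+ (k - c).
      by rewrite (@sigma_shift c.+1 k.+1) ?subSS // ltnW.
    rewrite -(ler_pM2r uc0) -(ler_pM2r sc0).
    have -> : sigma c.+1 * `|e| * `|dotv (u c.+1) b| * sigma c.+1 =
        sigma c.+1 * (`|e| * (sigma c.+1 * `|dotv (u c.+1) b|)) by ring.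
    rewrite h; apply: le_trans (_ : sigma (k + i).+1 * `|E i c| *
        (sigma k.+1 * `|dotv (u c.+1) b|) <= _).
      rewrite [leLHS](_ : _ = sigma (k + i).+1 * `|E i c| *
        (`|dotv (u (k + i).+1) b| * sigma c.+1)); last by ring.
      by rewrite ler_wpM2l // mulr_ge0 // ltW.
    rewrite [leRHS](_ : _ = sigma (k + i).+1 * (3 / 2) *
      (sigma k.+1 * `|dotv (u c.+1) b|)); last by rewrite shk; ring.
    by rewrite ler_wpM2r ?ler_wpM2l ?mulr_ge0 // ltW.
  rewrite -real_normK ?num_real //; have := lerXn2r 2 _ _ h.
  rewrite !nnegrE => /(_ (normr_ge0 _)) h2; apply: le_trans (h2 _) _.
    exact: le_trans (normr_ge0 _) h.
  rewrite (exprAC s 2 i) (exprAC s 2 (k - c)) le_eqVlt; apply/orP; left; apply/eqP.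
  by field.
apply: le_trans (ler_sum _ (fun c _ => ler_sum _ (fun i _ => Mle c i))) _.
under eq_bigr => c _ do rewrite -mulr_suml -mulr_sumr.
rewrite -mulr_sumr.
have := sum_expr_le (n - k) t_le; have := sum_exprB_le k t_le.
have /andP[t0 _] := t_le.
have : 0 <= \sum_(i < n - k) (s ^+ 2) ^+ i by apply: sumr_ge0 => i _; apply: exprn_ge0.
have : 0 <= \sum_(c < k) (s ^+ 2) ^+ (k - c) by apply: sumr_ge0 => c _; apply: exprn_ge0.
set S1 := \sum_(c < k) _; set S2 := \sum_(i < n - k) _ => p1 p2 h1 h2.
(* The two series contribute [4/9], which the squared weight bound [9/4] turns into exactly 1. *)
have h3 : S2 * S1 <= 4 / 3 * (1 / 3) by apply: ler_pM.
have := sqr_ge0 (sigma k.+1); set K := sigma k.+1 ^+ 2 => K0.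
by rewrite -mulrA; nra.
Qed.

End GeometricSingularValues.
End GeometricDecay.

(** * Coefficient decay up to the transition point *)

(** The minimum in the ratio is at most [|u_k^T b| = sigma_k^(1+beta)], so every later coefficient
    is at most [sigma_(k+1)^(1+beta)]. The rest is monotonicity of the power [beta]. *)
Lemma transition_point_decay (R : realType) m n (u : nat -> 'cV[R]_m)
    (sigma : nat -> R) b beta k0 k : 0 < beta ->
  (forall i j, (1 <= i)%N -> (i <= j)%N -> (j <= n)%N -> sigma j <= sigma i) ->
  (forall i, (1 <= i <= n)%N -> 0 < sigma i) ->
  transition_point n u sigma b beta k0 -> (1 <= k <= k0)%N ->
  forall c j, (1 <= c <= k)%N -> (k < j <= n)%N ->
    `|dotv (u j) b| * sigma c <= sigma k.+1 * `|dotv (u c) b|.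
Proof.
move=> beta0 sle s0 [k0n coef ratio] k1 c j ck kj.
have [kn ck0] : (k < n)%N /\ (1 <= c <= k0)%N by lia.
have sk0 : 0 < sigma k by apply: s0; lia.
have sk10 : 0 < sigma k.+1 by apply: s0; lia.
have sc0 : 0 < sigma c by apply: s0; lia.
have sck : sigma k.+1 <= sigma c by apply: sle; lia.
have [] := ratio k k1; rewrite /coef_ratio.
set mx := \big[Num.max/0]_(_ <= _ < _) _.
set mn := \big[Num.min/_]_(_ <= _ < _) _ => rE _.
have r0 : 0 < sigma k.+1 `^ (1 + beta) / sigma k `^ (1 + beta).
  by rewrite divr_gt0 ?powR_gt0.
(* A zero minimum would make the ratio 0, as the inverse of 0 is 0 by convention; the ratio is
   positive. *)
have mn0 : mn != 0 by apply: contraTneq r0 => m0; rewrite -rE m0 invr0 mulr0 ltxx.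
have mnk : mn <= sigma k `^ (1 + beta).
  rewrite -coef //; apply: (bigmin_inf_seq _ k) => //.
  by rewrite mem_index_iota; lia.
have jmx : `|dotv (u j) b| <= mx.
  apply: (le_bigmax_seq 0 j xpredT (fun i => `|dotv (u i) b|)) => //.
  by rewrite mem_index_iota; lia.
have mx_ratio : mx = sigma k.+1 `^ (1 + beta) / sigma k `^ (1 + beta) * mn.
  by rewrite -rE divfK.
have uj : `|dotv (u j) b| <= sigma k.+1 `^ (1 + beta).
  apply: le_trans jmx _; rewrite mx_ratio.
  apply: le_trans (ler_wpM2l (ltW r0) mnk) _.
  by rewrite divfK // gt_eqF // powR_gt0.
have powE x : 0 < x -> x `^ (1 + beta) = x * x `^ beta.
  by move=> x0; rewrite powRD ?powRr1 ?(ltW x0) // (gt_eqF x0) implybT.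
rewrite (coef c) // powE //; apply: le_trans (ler_wpM2r (ltW sc0) uj) _.
rewrite powE // -mulrA ler_pM2l // [leRHS]mulrC ler_pM2r //.
by apply: ge0_ler_powR; rewrite ?nnegrE ?(ltW beta0) ?(ltW sc0) ?(ltW sk10).
Qed.

(** * The near best criterion and the two decay regimes *)

Theorem theorem3p3 (R : realType) (m n : nat) (hmn : (n <= m)%N)
    (A : 'M[R]_(m, n)) (u : nat -> 'cV[R]_m) (v : nat -> 'cV[R]_n)
    (sigma : nat -> R) (hsvd : simple_svd A u v sigma)
    (xtrue : 'cV[R]_n) (e b : 'cV[R]_m) (hb : b = A *m xtrue + e)
    (hub : forall i, (1 <= i <= n)%N -> dotv (u i) b != 0)
    (alpha beta : nat -> R) (p : nat -> 'cV[R]_m) (q : nat -> 'cV[R]_n)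
    (hlan : lanczos_bidiag A b n alpha beta p q) :
  (forall k, (1 <= k < n)%N ->
     Num.sqrt (1 + krylov_eta n u sigma b k ^+ 2)
       < 1 / 2 * (sigma k / sigma k.+1) + 1 / 2 ->
     near_best A sigma k (lanczos_approx alpha beta p q k))
  /\
  (forall (betaP : R) (k0 kstar : nat),
     0 < betaP ->
     picard n u sigma (A *m xtrue) betaP ->
     transition_point n u sigma b betaP k0 ->
     semi_convergence_at (lsqr_iterate b alpha beta p q) xtrue kstar ->
     (kstar <= k0)%N ->
     (forall zeta rho : R, 0 < zeta -> 2 < rho ->
        (forall i, (1 <= i <= n)%N -> sigma i = zeta * rho ^- i) ->
        forall k, (1 <= k <= kstar)%N ->
          near_best A sigma k (lanczos_approx alpha beta p q k))
     /\
     (forall zeta a : R, 0 < zeta -> 1 / 2 < a ->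
        (forall i, (1 <= i <= n)%N -> sigma i = zeta * i%:R `^ (- a)) ->
        (forall k, (1 <= k <= kstar)%N ->
           2 * Num.sqrt (1 + krylov_eta n u sigma b k ^+ 2) - 1
             < (k.+1%:R / k%:R) `^ a) ->
        forall k, (1 <= k <= kstar)%N ->
          near_best A sigma k (lanczos_approx alpha beta p q k))).
Proof.
have s0 := svd_pos hsvd.
have part1 k : (1 <= k < n)%N ->
     Num.sqrt (1 + krylov_eta n u sigma b k ^+ 2)
       < 1 / 2 * (sigma k / sigma k.+1) + 1 / 2 ->
     near_best A sigma k (lanczos_approx alpha beta p q k).
  move=> /andP[k1 kn] h; have sk0 : 0 < sigma k.+1 by exact: s0.
  rewrite /near_best (sigma_le_residual_norm hmn hsvd hlan kn) /=.
  apply: le_lt_trans (residual_norm_le_eps hmn hsvd hub hlan kn) _.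
  (* Factoring [sigma_(k+1)] out of the root and out of the midpoint reduces the bound to the
     assumed inequality. *)
  have -> : sigma k.+1 ^+ 2 + krylov_eps n u sigma b k ^+ 2 =
      sigma k.+1 ^+ 2 * (1 + krylov_eta n u sigma b k ^+ 2).
    by rewrite /krylov_eta; field; rewrite gt_eqF.
  rewrite sqrtrM ?sqr_ge0 // sqrtr_sqr gtr0_norm //.
  have -> : (sigma k + sigma k.+1) / 2 =
      sigma k.+1 * (1 / 2 * (sigma k / sigma k.+1) + 1 / 2).
    by field; rewrite gt_eqF.
  by rewrite ltr_pM2l.
split=> // betaP k0 kstar beta0 _ tp _ ksk0; have k0n := transition_range tp.
split=> [zeta rho z0 rho2 sE k kks|zeta a z0 a2 sE hk k kks].
  have [kn k1] : (k < n)%N /\ (1 <= k <= k0)%N by lia.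
  have kpos : (1 <= k)%N by case/andP: k1.
  have rho0 : 0 < rho by lra.
  have r1 : 0 < rho^-1 <= 1 / 2.
    by rewrite invr_gt0 rho0 /= -[1 / 2]invrK lef_pV2 ?posrE ?invr_gt0; lra.
  have sE' i : (1 <= i <= n)%N -> sigma i = zeta * rho^-1 ^+ i.
    by move=> hi; rewrite sE // exprVn.
  have sk0 : 0 < sigma k.+1 by exact: s0.
  have slt i j := @svd_lt _ _ _ _ _ _ _ hsvd i j.
  have sle i j := @svd_le _ _ _ _ _ _ _ hsvd i j.
  have hdec := transition_point_decay beta0 sle s0 tp k1.
  have hD := krylov_Delta_geometric kn slt s0 r1 sE' hub hdec.
  rewrite /near_best (sigma_le_residual_norm hmn hsvd hlan kn) /=.
  apply: le_lt_trans (residual_norm_le_Delta hmn hsvd hub hlan kn hD) _.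
  have skE : sigma k = rho * sigma k.+1.
    by rewrite (sE' k.+1) ?(sE' k) ?kpos ?(ltnW kn) // exprS; field; rewrite gt_eqF.
  have : 2 * sigma k.+1 < sigma k by rewrite skE ltr_pM2r.
  set x := sigma k.+1 in sk0 * => hx.
  (* After squaring, [2 x^2] is compared with the square of the midpoint, which exceeds [9/4 x^2]
     because [sigma_k > 2 x]. *)
  rewrite -(@ltr_pXn2r _ 2) ?nnegrE ?sqrtr_ge0 ?sqr_sqrtr //; nra.
have [kn k1] : (k < n)%N /\ (1 <= k)%N by lia.
apply: part1; rewrite ?k1 //.
(* With this ratio, the condition on the exponent is a rearrangement of the criterion of the first
   part. *)
have -> : sigma k / sigma k.+1 = (k.+1%:R / k%:R) `^ a.
  have kp : 0 < k%:R :> R by rewrite ltr0n.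
  have kp1 : 0 < k.+1%:R :> R by rewrite ltr0n.
  rewrite !sE ?(ltnW kn) ?k1 // powRM ?invr_ge0 ?ler0n // -(powR_inv1 (ltW kp)).
  rewrite -powRrM mulN1r !powRN; field.
  by rewrite !gt_eqF ?powR_gt0.
by have := hk k kks; lra.
Qed.
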